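(* Let $\kappa,k\in\mathbb Z_+$ and let $\mathbf s=(s_j)_{j\ge0}\in\mathcal H_\kappa^{k,reg}$, with normal indices $n_1<n_2<\cdots$ and generalized Stieltjes polynomials $P_j^+$, $Q_j^+$. Then for every $j\in\mathbb N$ the $[n_j/n_j-1]$ Padé approximant for the formal power series $-\sum_{i=0}^\infty \frac{s_i}{z^{i+1}}$ exists and has the form $$f^{[n_j/n_j-1]}(z)=\frac{Q_{2j-1}^+(z)}{P_{2j-1}^+(z)}.$$
   Context: $\mathbb N=\{1,2,\dots\}$, $\mathbb Z_+=\mathbb N\cup\{0\}$. **Padé approximants.** The $[L/M]$ Padé approximant for $-\sum_{j\ge0}s_jz^{-j-1}$ is a ratio $f^{[L/M]}(z)=\frac{A^{[L/M]}(1/z)}{B^{[L/M]}(1/z)}$ of polynomials $A^{[L/M]}$, $B^{[L/M]}$ of formal degree $L$, $M$ respectively (i.e. degrees at most $L$, $M$), such that $B^{[L/M]}(0)\ne0$ and $f^{[L/M]}(z)+\sum_{j=0}^{L+M}\frac{s_j}{z^{j+1}}=O\left(\frac1{z^{L+M+1}}\right)$ as $z\to\infty$ nontangentially. **Sequences.** For a real sequence $\mathbf s$: $S_n=(s_{i+j})_{i,j=0}^{n-1}$, $S_n^+=(s_{i+j+1})_{i,j=0}^{n-1}$, $\nu_-(A)$ is the number of negative eigenvalues of $A$. $n\in\mathbb N$ is a normal index if $\det S_n\ne0$; the normal indices are $n_1<n_2<\cdots$ (infinitely many), $n_0:=0$. $\mathcal H_\kappa^{k,reg}$ is the set of $\mathbf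 s$ with $\nu_-(S_n)=\kappa$ and $\nu_-(S_n^+)=k$ for all large $n$, and $\det S_{n_j}^+\neq0$ for all $j\in\mathbb N$. **P-fraction.** For such $\mathbf s$ there are unique real monic polynomials $a_i$ of degree $n_{i+1}-n_i$ and numbers $b_i\in\mathbb R\setminus\{0\}$ ($i\in\mathbb Z_+$) such that the solutions $P_j$, $Q_j$ of $b_jy_{j-1}-a_j(z)y_j+y_{j+1}=0$ ($j\in\mathbb Z_+$) with $P_{-1}=0$, $P_0=1$, $Q_{-1}=-1$, $Q_0=0$ satisfy $-\frac{Q_j(z)}{P_j(z)}=-\sum_{i=0}^{2n_j-1}\frac{s_i}{z^{i+1}}+O(z^{-2n_j-1})$, $z\to\infty$, for all $j\in\mathbb N$. **Generalized $S$-fraction.** For $\mathbf s\in\mathcal H_\kappa^{k,reg}$ there are unique real polynomials $m_j(z)\not\equiv0$ and numbers $l_j\in\mathbb R\setminus\{0\}$ such that for every $j\in\mathbb N$ the finite continued fraction $$\cfrac{1}{-zm_1(z)+\cfrac{1}{l_1+\cdots+\cfrac{1}{-zm_j(z)+\cfrac1{l_j}}}}$$ equals $-Q_j(z)/P_j(z)$. **Generalized Stieltjes polynomials** $P_j^+,Q_j^+$ ($j\ge-1$) are the solutions of $y_{2j-1}-y_{2j-3}=-zm_j(z)y_{2j-2}$, $y_{2j}-y_{2j-2}=l_jy_{2j-1}$ ($j\in\mathbb N$) with $P_{-1}^+=0$, $P_0^+=1$, $Q_{-1}^+=1$, $Q_0^+=0$. *)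

(* Defs.v *)
From HB Require Import structures.
From mathcomp Require Import all_boot all_order all_algebra.
From mathcomp Require Import complex polyrcf.
From mathcomp Require Import boolp classical_sets functions filter reals topology.
From mathcomp Require Import normedtype landau.

Set Implicit Arguments.
Unset Strict Implicit.
Unset Printing Implicit Defensive.

Import Order.TTheory GRing.Theory Num.Theory.
Import numFieldNormedType.Exports.

Local Open Scope classical_set_scope.
Local Open Scope ring_scope.
Local Open Scope complex_scope.

Section Infinity.
Variable R : realType.

Definition cinfty_nbhs : set_system R[i] :=
  filter_from [set: R] (fun M => [set z | M%:C < `|z|]).

Global Instance cinfty_nbhs_filter : ProperFilter cinfty_nbhs.
Proof.
apply: filter_from_proper; last first.
  move=> M _; exists (`|M| + 1)%:C => /=.
  rewrite ger0_norm; first by rewrite ltcR (le_lt_trans (ler_norm _)) ?ltrDl.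
  by rewrite ler0c addr_ge0.
apply: filter_from_filter; first by exists 0.
move=> M N _ _; exists (Num.max M N) => // z /= h; split;
  by apply: le_lt_trans h; rewrite lecR le_max lexx ?orbT.
Qed.

(* Since Im z = |z| sin (arg z), taking delta = sin eps this is the filter of
   z -> oo in the sector eps < arg z < pi - eps; z -> oo nontangentially
   amounts to this for every delta > 0 (the sector is empty if delta >= 1). *)
Definition nontangential_nbhs (delta : R) : set_system R[i] :=
  within [set z | delta%:C * `|z| < 'Im z] cinfty_nbhs.

Global Instance nontangential_nbhs_filter (delta : R) :
  Filter (nontangential_nbhs delta).
Proof. exact: within_filter. Qed.

Canonical cinfty_filter_on := FilterType cinfty_nbhs _.

Canonical nontangential_filter_on (delta : R) :=
  FilterType (nontangential_nbhs delta) _.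

End Infinity.

Section Hankel.
Variable R : realType.
Implicit Types (s : nat -> R) (n : nat).

Definition hankel s n : 'M[R]_n := \matrix_(i < n, j < n) s (i + j)%N.

Definition shifted_hankel s n : 'M[R]_n := \matrix_(i < n, j < n) s (i + j).+1.

(* Eigenvalues are counted with multiplicity. *)
Definition nu_minus n (A : 'M[R]_n) : nat :=
  (\sum_(x <- rootsR (char_poly A) | (x < 0)%R) mup x (char_poly A))%N.

Definition normal_index s n : Prop := (0 < n)%N /\ \det (hankel s n) != 0.

(* [ni 1 < ni 2 < ...] lists all the normal indices, which are therefore
   infinitely many, and [ni 0 = 0]. *)
Definition normal_indices s (ni : nat -> nat) : Prop :=
  [/\ ni 0%N = 0%N,
      forall j, (ni j < ni j.+1)%N &
      forall n, normal_index s n <-> exists2 j, (0 < j)%N & ni j = n].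

Definition H_reg (kappa k : nat) s : Prop :=
  [/\ forall N, exists2 n, (N <= n)%N & normal_index s n,
      exists N, forall n, (N <= n)%N ->
        nu_minus (hankel s n) = kappa /\ nu_minus (shifted_hankel s n) = k &
      forall n, normal_index s n -> \det (shifted_hankel s n) != 0].

End Hankel.

Section Rational.
Variable R : realType.
Implicit Types (p : {poly R}) (s : nat -> R).

Definition ceval p (z : R[i]) : R[i] := (map_poly (real_complex R) p).[z].

Definition moment_sum s N (z : R[i]) : R[i] :=
  \sum_(i < N) (s i)%:C / z ^+ i.+1.

(* The rational function p(1/z). *)
Definition at_inverse p : {fraction {poly R}} :=
  (map_poly (fun c : R => tofrac c%:P) p).[(tofrac 'X)^-1].

Definition pade_approximant s (L M : nat) (f : {fraction {poly R}}) : Prop :=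
  exists A B : {poly R},
    [/\ (size A <= L.+1)%N /\ (size B <= M.+1)%N,
        B.[0] != 0,
        f = at_inverse A / at_inverse B &
        forall delta : R, 0 < delta ->
          (fun z => ceval A z^-1 / ceval B z^-1
                    + moment_sum s (L + M).+1 z : R[i]^o)%R
          =O_ (nontangential_nbhs delta) (fun z => z ^- (L + M).+1 : R[i]^o)%R].

End Rational.

Section PFraction.
Variable R : realType.
Implicit Types (s : nat -> R) (ni : nat -> nat).
Implicit Types (a : nat -> {poly R}) (b : nat -> R).

(* The pair (y_(j-1), y_j) for the solution of
   b_j y_(j-1) - a_j y_j + y_(j+1) = 0 with initial values y_(-1), y_0. *)
Fixpoint three_term a b (y : {poly R} * {poly R}) (j : nat) :=
  if j is i.+1 then
    let: (u, v) := three_term a b y i in (v, a i * v - b i *: u)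
  else y.

Definition P_poly a b j : {poly R} := (three_term a b (0, 1) j).2.

Definition Q_poly a b j : {poly R} := (three_term a b (-1, 0) j).2.

Definition P_fraction s ni a b : Prop :=
  [/\ forall i, a i \is monic /\ size (a i) = (ni i.+1 - ni i).+1,
      forall i, b i != 0 &
      forall j, (0 < j)%N ->
        (fun z => - (ceval (Q_poly a b j) z / ceval (P_poly a b j) z)
                  + moment_sum s (2 * ni j) z : R[i]^o)%R
        =O_ (@cinfty_nbhs R) (fun z => z ^- (2 * ni j).+1 : R[i]^o)%R].

End PFraction.

Section SFraction.
Variable R : realType.
(* Indexed from 1: the values at 0 are not used. *)
Implicit Types (m : nat -> {poly R}) (l : nat -> R).

(* [S_cfrac m l i n] is the finite continued fraction with the n pairs of
   entries (m_i, l_i), ..., (m_(i+n-1), l_(i+n-1)). *)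
Fixpoint S_cfrac m l (i n : nat) : {fraction {poly R}} :=
  if n is n'.+1 then
    (- tofrac ('X * m i) + (tofrac (l i)%:P + S_cfrac m l i.+1 n')^-1)^-1
  else 0.

Definition S_fraction a b m l : Prop :=
  (forall j, (0 < j)%N -> m j != 0 /\ l j != 0) /\
  (forall j, (0 < j)%N ->
     S_cfrac m l 1%N j = - (tofrac (Q_poly a b j) / tofrac (P_poly a b j))).

(* The pair (y_(2j-1), y_(2j)) for the solution of the system
   y_(2j-1) - y_(2j-3) = - z m_j y_(2j-2), y_(2j) - y_(2j-2) = l_j y_(2j-1)
   with initial values y_(-1), y_0. *)
Fixpoint stieltjes_system m l (y : {poly R} * {poly R}) (j : nat) :=
  if j is i.+1 then
    let: (u, v) := stieltjes_system m l y i in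
    let u' := u - 'X * m j * v in (u', v + l j *: u')
  else y.

(* For i >= 0, [P_plus m l i] and [Q_plus m l i] are P_i^+ and Q_i^+. *)
Definition P_plus m l (i : nat) : {poly R} :=
  let y := stieltjes_system m l (0, 1) (uphalf i) in if odd i then y.1 else y.2.

Definition Q_plus m l (i : nat) : {poly R} :=
  let y := stieltjes_system m l (1, 0) (uphalf i) in if odd i then y.1 else y.2.

End SFraction.

(* Main.v *)
(* Consecutive convergents Q^+_(2j-1)/P^+_(2j-1) and Q^+_(2j)/P^+_(2j) of the
   S-fraction differ by 1/(P^+_(2j-1) P^+_(2j)), and the second one is
   -Q_j/P_j. Both of its representations are in lowest terms, so P^+_(2j) has
   the degree n_j of P_j, and so has P^+_(2j-1) because l_j is a nonzero
   constant. The difference is thus O(z^(-2 n_j)), within the Pade order, while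
   z divides P^+_(2j-1), which lowers by one the degree of the denominator in
   1/z. Uniqueness is the usual cross-multiplication argument: AB' - A'B has
   degree at most L+M in w = 1/z and is O(w^(L+M+1)), hence vanishes. *)

Require Import Defs.
From mathcomp Require Import all_boot all_order all_algebra.
From mathcomp Require Import complex.
From mathcomp Require Import boolp classical_sets functions filter reals.
From mathcomp Require Import topology normedtype landau ring.

Set Implicit Arguments.
Unset Strict Implicit.
Unset Printing Implicit Defensive.

Import Order.TTheory GRing.Theory Num.Theory.
Import numFieldNormedType.Exports.

Local Open Scope classical_set_scope.
Local Open Scope ring_scope.
Local Open Scope complex_scope.

(** * Passage between polynomials in z and polynomials in 1/z *)

Section Reversal.

(** For [size p <= n.+1], the reciprocal polynomial [w^n p(1/w)]. The formal degree [n] may exceed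
    that of [p]. *)
Definition revp (R : nzSemiRingType) n (p : {poly R}) : {poly R} :=
  \poly_(i < n.+1) p`_(n - i).

Lemma size_revp (R : nzSemiRingType) n (p : {poly R}) :
  (size (revp n p) <= n.+1)%N.
Proof. exact: size_poly. Qed.

Lemma size_revp_root0 (R : nzSemiRingType) n (p : {poly R}) :
  p`_0 = 0 -> (size (revp n p) <= n)%N.
Proof.
move=> p0; apply/leq_sizeP => i.
rewrite leq_eqVlt coef_poly ltnS => /predU1P[<-|].
  by rewrite leqnn subnn.
by rewrite ltnNge => /negbTE ->.
Qed.

Lemma revp_horner0 (R : nzSemiRingType) n (p : {poly R}) :
  (revp n p).[0] = p`_n.
Proof. by rewrite horner_coef0 coef_poly subn0. Qed.

Lemma revpK (R : nzSemiRingType) n (p : {poly R}) :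
  (size p <= n.+1)%N -> revp n (revp n p) = p.
Proof.
move=> sp; apply/polyP => i; rewrite !coef_poly !ltnS leq_subr.
case: leqP => [/subKn -> //|lt_ni].
by rewrite nth_default // (leq_trans sp).
Qed.

Lemma map_revp (R S : nzRingType) (f : {rmorphism R -> S}) n (p : {poly R}) :
  map_poly f (revp n p) = revp n (map_poly f p).
Proof.
apply/polyP => i; rewrite coef_map !(coef_poly n.+1) coef_map.
by case: ifP => // _; exact: rmorph0.
Qed.

Lemma horner_revp (F : fieldType) n (p : {poly F}) (x : F) :
  (size p <= n.+1)%N -> x != 0 -> (revp n p).[x^-1] = p.[x] / x ^+ n.
Proof.
move=> sp x0; rewrite horner_poly (horner_coef_wide _ sp) mulr_suml.
rewrite (reindex_inj rev_ord_inj) /=; apply: eq_bigr => i _.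
have le_in : (i <= n)%N by rewrite -ltnS.
rewrite subSS subKn // -mulrA exprVn expfB_cond ?(negbTE x0) //.
by rewrite invf_div.
Qed.

(** Exposes the coefficient map as a composite of ring morphisms, so that the morphism lemmas apply
    to [map_poly]. *)
Lemma at_inverseE (R : realType) (p : {poly R}) :
  at_inverse p = (map_poly (@tofrac _ \o polyC) p).[(tofrac 'X)^-1].
Proof. by []. Qed.

Lemma at_inverseM (R : realType) (p q : {poly R}) :
  at_inverse (p * q) = at_inverse p * at_inverse q.
Proof. by rewrite !at_inverseE rmorphM hornerM. Qed.

Lemma at_inverse_revp (R : realType) n (p : {poly R}) : (size p <= n.+1)%N ->
  at_inverse (revp n p) = tofrac p / tofrac 'X ^+ n.
Proof.
move=> sp; rewrite at_inverseE map_revp.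
rewrite horner_revp ?tofrac_eq0 ?polyX_eq0 //; last first.
  exact: leq_trans (size_poly _ _) sp.
by rewrite map_poly_comp horner_map -[_.['X]]/(p \Po 'X) comp_polyXr.
Qed.

(** [p] is the reversal of its own reversal, so its value at the inverse is a nonzero polynomial
    over a power of ['X]. *)
Lemma at_inverse_neq0 (R : realType) (p : {poly R}) :
  p != 0 -> at_inverse p != 0.
Proof.
have [n sp] : exists n, (size p <= n.+1)%N by exists (size p).
move=> p0; rewrite -(revpK sp) at_inverse_revp ?size_revp //.
rewrite mulf_neq0 ?invr_eq0 ?expf_neq0 ?tofrac_eq0 ?polyX_eq0 //.
apply: contra_neq p0 => r0; rewrite -(revpK sp) r0.
by apply/polyP => i; rewrite coef_poly !coef0; case: ifP.
Qed.

End Reversal.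

(** * Stieltjes polynomials and convergents of the S-fraction *)

Section Convergents.
Variable R : realType.
Implicit Types (m : nat -> {poly R}) (l : nat -> R) (y : {poly R} * {poly R}).

(** The recursion peels off the last pair of entries, [S_cfrac] the first; restarting after one step
    reconciles them. *)
Lemma stieltjes_system_head m l y n :
  stieltjes_system m l y n.+1 =
  stieltjes_system (fun i => m i.+1) (fun i => l i.+1)
    (stieltjes_system m l y 1) n.
Proof.
elim: n => // n IHn.
by rewrite -[LHS]/(let: (u, v) := stieltjes_system m l y n.+1 in _) IHn.
Qed.

Lemma stieltjes_system_lin m l u v n :
  let P := stieltjes_system m l (0, 1) n in
  let Q := stieltjes_system m l (1, 0) n in
  stieltjes_system m l (u, v) n = (u * Q.1 + v * P.1, u * Q.2 + v * P.2).
Proof.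
elim: n => /= [|n ->]; first by congr (_, _); ring.
case: (stieltjes_system m l (0, 1) n) (stieltjes_system m l (1, 0) n)
  => p1 p2 [q1 q2] /=.
by rewrite -!mul_polyC; congr (_, _); ring.
Qed.

(** Each step applies two transvections to both solutions, so their determinant keeps its initial
    value. *)
Lemma stieltjes_det m l n :
  let P := stieltjes_system m l (0, 1) n in
  let Q := stieltjes_system m l (1, 0) n in Q.1 * P.2 - Q.2 * P.1 = 1.
Proof.
elim: n => /= [|n]; first by ring.
case: (stieltjes_system m l (0, 1) n) (stieltjes_system m l (1, 0) n)
  => p1 p2 [q1 q2] /= <-.
by rewrite -!mul_polyC; ring.
Qed.

(** [size (m i)] is the degree of ['X * m i], so [d] is the total degree gained. The new product
    dominates all earlier terms; [n = 0] is apart because P_{-1}^+ = 0. *)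
Lemma size_stieltjes m l n :
  (forall i, (0 < i)%N -> m i != 0 /\ l i != 0) ->
  let d := (\sum_(1 <= i < n.+1) size (m i))%N in
  let P := stieltjes_system m l (0, 1) n in
  let Q := stieltjes_system m l (1, 0) n in
  [/\ size P.2 = d.+1, size P.1 = if n is 0 then 0%N else d.+1,
      (size Q.2 <= d)%N & (size Q.1 <= d.+1)%N].
Proof.
move=> ml; elim: n => [|n] /=.
  by rewrite big_nil size_poly0 size_poly1.
rewrite [in X in _ -> X]big_nat_recr //=.
set d := (\sum_(1 <= i < n.+1) size (m i))%N.
have [m0 l0] := ml n.+1 isT.
case: (stieltjes_system m l (0, 1) n) (stieltjes_system m l (1, 0) n)
  => p1 p2 [q1 q2] /= [sp2 sp1 sq2 sq1].
have sm : (0 < size (m n.+1))%N by rewrite size_poly_gt0.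
have p20 : p2 != 0 by rewrite -size_poly_gt0 sp2.
have Xm0 : 'X * m n.+1 != 0 by rewrite mulf_neq0 ?polyX_eq0.
have sXm : size ('X * m n.+1) = (size (m n.+1)).+1 by rewrite mulrC size_mulX.
have dlt : (d < d + size (m n.+1))%N by rewrite -[ltnLHS]addn0 ltn_add2l.
have su : size (p1 - 'X * m n.+1 * p2) = (d + size (m n.+1)).+1.
  have sM : size ('X * m n.+1 * p2) = (d + size (m n.+1)).+1.
    by rewrite size_mul // sXm sp2 addnS /= addSn addnC.
  rewrite addrC size_polyDl size_polyN sM // ltnS (leq_trans _ dlt) // sp1.
  by case: (n) (d).
have sv : size (p2 + l n.+1 *: (p1 - 'X * m n.+1 * p2)) =
    (d + size (m n.+1)).+1.
  by rewrite addrC size_polyDl size_scale // su // sp2 ltnS.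
have tu : (size (q1 - 'X * m n.+1 * q2)%R <= d + size (m n.+1))%N.
  rewrite (leq_trans (size_polyD _ _)) // size_polyN geq_max.
  rewrite (leq_trans sq1) //=.
  by rewrite (leq_trans (size_polyMleq _ _)) // sXm addSn /= addnC leq_add2r.
split=> //; last exact: leqW.
rewrite (leq_trans (size_polyD _ _)) // geq_max (leq_trans sq2) ?leq_addr //=.
by rewrite size_scale.
Qed.

(* No denominator of the continued fraction vanishes, by degree, so the junk
   value 0^-1 = 0 never occurs in [S_cfrac]. *)
Lemma stieltjes_S_cfrac m l i n :
  (forall k, (0 < k)%N -> m k != 0 /\ l k != 0) ->
  let mi k := m (i + k)%N in let li k := l (i + k)%N in
  let P := stieltjes_system mi li (0, 1) n in
  let Q := stieltjes_system mi li (1, 0) n in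
  S_cfrac m l i.+1 n = tofrac Q.2 / tofrac P.2.
Proof.
move=> ml; elim: n i => [|n IHn] i; first by rewrite /= tofrac0 mul0r.
have mlS k h : (0 < h)%N -> m (k + h)%N != 0 /\ l (k + h)%N != 0.
  by move=> h0; apply: ml; rewrite addn_gt0 h0 orbT.
have [sP' _ sQ' _] := size_stieltjes n (mlS i.+1).
have [_ l0] := ml i.+1 isT.
have shift (f : nat -> {poly R}) :
    (fun k => f (i + k.+1)%N) = (fun k => f (i.+1 + k)%N).
  by apply/funext => k; rewrite addnS.
have shiftl : (fun k => l (i + k.+1)%N) = (fun k => l (i.+1 + k)%N).
  by apply/funext => k; rewrite addnS.
lazy zeta.
(* After one step the systems restart from (-zm, 1 - lzm) for P and (1, l) for Q; linearity expands
   both in the basic solutions of the shifted system. *)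
rewrite !(stieltjes_system_head _ _ _ n) shift shiftl /= IHn.
rewrite addn1 mulr0 subr0 mulr1 !add0r.
rewrite (stieltjes_system_lin _ _ 1) (stieltjes_system_lin _ _ (- _)) /=.
set P := stieltjes_system _ _ (0, 1) n in sP' *.
set Q := stieltjes_system _ _ (1, 0) n in sQ' *.
have p0 : P.2 != 0 by rewrite -size_poly_gt0 sP'.
have w0 : Q.2 + l i.+1 *: P.2 != 0.
  by rewrite -size_poly_gt0 addrC size_polyDl size_scale // sP'.
rewrite alg_polyC mul1r -!mul_polyC; rewrite -mul_polyC in w0.
have -> : tofrac (l i.+1)%:P + tofrac Q.2 / tofrac P.2
    = tofrac (Q.2 + (l i.+1)%:P * P.2) / tofrac P.2.
  by rewrite tofracD tofracM mulrDl mulfK ?tofrac_eq0 // addrC.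
have -> : - ('X * m i.+1) * Q.2 + (1 + (l i.+1)%:P * - ('X * m i.+1)) * P.2
    = - ('X * m i.+1) * (Q.2 + (l i.+1)%:P * P.2) + P.2 by ring.
move: w0; move: (Q.2 + _) => W w0.
by rewrite invf_div -[RHS]invf_div tofracD mulrDl (tofracM (- _)) tofracN
  mulfK ?tofrac_eq0.
Qed.

Lemma stieltjes_S_cfrac1 m l n :
  (forall k, (0 < k)%N -> m k != 0 /\ l k != 0) ->
  S_cfrac m l 1 n = tofrac (stieltjes_system m l (1, 0) n).2
    / tofrac (stieltjes_system m l (0, 1) n).2.
Proof. exact: stieltjes_S_cfrac 0%N n. Qed.

(** * The P-fraction and the comparison of degrees *)

Implicit Types (a : nat -> {poly R}) (b : nat -> R).

(** The step matrix has determinant [b j], so [c] is the product of the first [j] coefficients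
    [b i]. *)
Lemma three_term_det a b j : (forall i, b i != 0) ->
  let P := three_term a b (0, 1) j in
  let Q := three_term a b (-1, 0) j in
  exists2 c, c != 0 & Q.2 * P.1 - Q.1 * P.2 = c%:P.
Proof.
move=> b0; elim: j => [|j] /=.
  by exists 1; rewrite ?oner_neq0 // polyC1; ring.
case: (three_term a b (0, 1) j) (three_term a b (-1, 0) j)
  => p1 p2 [q1 q2] /= [c c0 e].
exists (b j * c); first by rewrite mulf_neq0.
by rewrite polyCM -e -!mul_polyC; ring.
Qed.

Lemma size_three_term a b (ni : nat -> nat) j :
  ni 0%N = 0%N -> (forall i, (ni i < ni i.+1)%N) ->
  (forall i, a i \is monic /\ size (a i) = (ni i.+1 - ni i).+1) ->
  let P := three_term a b (0, 1) j in
  size P.2 = (ni j).+1 /\ (size P.1 <= (ni j).+1)%N.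
Proof.
move=> ni0 ltni ha; elim: j => [|j] /=.
  by rewrite size_poly0 size_poly1 ni0.
case: (three_term a b (0, 1) j) => p1 p2 /= [sp2 sp1].
have [_ sa] := ha j.
have sM : size (a j * p2) = (ni j.+1).+1.
  rewrite size_mul -?size_poly_gt0 ?sa ?sp2 // addnS /=.
  by rewrite addSn subnK // ltnW.
split; last by rewrite sp2 ltnS ltnW.
rewrite size_polyDl ?size_polyN sM // ltnS.
by rewrite (leq_trans (size_scale_leq _ _)) // (leq_trans sp1).
Qed.

(** After cross-multiplication, Gauss's lemma makes each denominator divide the other. *)
Lemma coprime_frac_size (p1 q1 p2 q2 : {poly R}) :
  coprimep p1 q1 -> coprimep p2 q2 -> p1 != 0 -> p2 != 0 ->
  tofrac q1 / tofrac p1 = tofrac q2 / tofrac p2 -> size p1 = size p2.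
Proof.
move=> c1 c2 p10 p20 /eqP.
rewrite eqr_div ?tofrac_eq0 // -!tofracM tofrac_eq => /eqP e.
apply: eqp_size; rewrite /eqp -(Gauss_dvdpr _ c1) e dvdp_mulIr /=.
by rewrite -(Gauss_dvdpr _ c2) -e dvdp_mulIr.
Qed.

Lemma size_stieltjes_S_fraction a b m l (ni : nat -> nat) j :
  ni 0%N = 0%N -> (forall i, (ni i < ni i.+1)%N) ->
  (forall i, a i \is monic /\ size (a i) = (ni i.+1 - ni i).+1) ->
  (forall i, b i != 0) -> S_fraction a b m l -> (0 < j)%N ->
  (\sum_(1 <= i < j.+1) size (m i))%N = ni j.
Proof.
move=> ni0 ltni ha b0 [ml Sfrac] j0.
have [sP _ _ _] := size_stieltjes j ml.
have det := stieltjes_det m l j.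
have [sT _] := size_three_term b j ni0 ltni ha.
have [c c0 detT] := three_term_det a j b0.
have := Sfrac j j0; rewrite (stieltjes_S_cfrac1 j ml) -mulNr -tofracN.
move=> /coprime_frac_size e.
apply: succn_inj; rewrite -sP -sT; apply: e; rewrite -?size_poly_gt0 ?sP ?sT //.
  (* The determinant identities serve as Bezout relations, with value 1 here and a nonzero constant
     for the P-fraction. *)
  apply/Bezout_eq1_coprimepP.
  exists ((stieltjes_system m l (1, 0) j).1,
          - (stieltjes_system m l (0, 1) j).1).
  by rewrite /= -[RHS]det /=; ring.
apply/Bezout_coprimepP.
exists (- (three_term a b (-1, 0) j).1, - (three_term a b (0, 1) j).1).
rewrite /= -size_poly_eq1.
have -> : - (three_term a b (-1, 0) j).1 * (three_term a b (0, 1) j).2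
    + - (three_term a b (0, 1) j).1 * - Q_poly a b j = c%:P.
  by rewrite -detT /Q_poly; ring.
by rewrite size_polyC c0.
Qed.

End Convergents.

(** * Estimates as z tends to infinity *)

Section Infinity.
Variable R : realType.
Implicit Types (p : {poly R}) (q : {poly R[i]}).

Lemma near_cinfty_gt (M : R[i]) :
  M \is Num.real -> \forall z \near @cinfty_nbhs R, M < `|z|.
Proof. by move=> /RRe_real <-; exists (complex.Re M). Qed.

Lemma cvg_cinfty_inv :
  (fun z : R[i] => z^-1 : R[i]^o) @ @cinfty_nbhs R --> (0 : R[i]^o).
Proof.
apply/cvgrPdist_lt => e e0.
near=> z; rewrite sub0r normrN normfV.
have ez : e^-1 < `|z| by near: z; apply: near_cinfty_gt;
  rewrite gtr0_real ?invr_gt0.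
by rewrite invf_plt ?posrE // (lt_trans _ ez) ?invr_gt0.
Unshelve. all: by end_near.
Qed.

Lemma cvg_cinfty_horner_inv q :
  (fun z : R[i] => q.[z^-1] : R[i]^o) @ @cinfty_nbhs R --> (q.[0] : R[i]^o).
Proof.
elim/poly_ind: q => [|q c IHq].
  under eq_fun do rewrite horner0.
  rewrite horner0; exact: cvg_cst.
under eq_fun do rewrite hornerMXaddC.
rewrite hornerMXaddC; apply: cvgD; last exact: cvg_cst.
rewrite -[q.[0] * 0]/(q.[0] *: (0 : R[i]^o)).
exact: (@cvgZ _ _ _ _ _ (fun z => q.[z^-1]) (fun z : R[i] => z^-1 : R[i]^o)
  _ _ IHq cvg_cinfty_inv).
Qed.

Lemma near_cinfty_horner_inv q : q.[0] != 0 ->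
  \forall z \near @cinfty_nbhs R, `|q.[0]| / 2 <= `|q.[z^-1]| <= `|q.[0]| * 2.
Proof.
move=> q0; have /cvgrPdist_lt qc := @cvg_cinfty_horner_inv q.
have e0 : 0 < `|q.[0]| / 2 by rewrite divr_gt0 ?normr_gt0.
near=> z.
have : `|q.[0] - q.[z^-1]| <= `|q.[0]| / 2 by apply: ltW; near: z; exact: qc.
set a := q.[0]; set b := q.[z^-1] => ab.
have a2 : `|a| - `|a| / 2 = `|a| / 2 by field.
apply/andP; split.
  rewrite -a2 lerBlDl (le_trans _ (lerD ab (lexx `|b|))) //.
  by rewrite (le_trans _ (ler_normD _ _)) // subrK.
rewrite -[b](subKr a) (le_trans (ler_normB _ _)) // mulr_natr mulr2n lerD2l.
by rewrite (le_trans ab) // -subr_ge0 a2 ltW.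
Unshelve. all: by end_near.
Qed.

Lemma ceval_revp n p (z : R[i]) : (size p <= n.+1)%N -> z != 0 ->
  ceval (revp n p) z^-1 = ceval p z / z ^+ n.
Proof.
move=> sp z0; rewrite /ceval map_revp horner_revp //.
exact: leq_trans (size_poly _ _) sp.
Qed.

(** [p(z) / z^n] is the reversal of [p] at 1/z, which tends to the nonzero leading coefficient. *)
Lemma ceval_norm_ge n p : size p = n.+1 ->
  exists2 K : R[i], 0 < K &
    \forall z \near @cinfty_nbhs R, K * `|z| ^+ n <= `|ceval p z|.
Proof.
move=> sp; pose q := map_poly (real_complex R) (revp n p).
have pn : (p`_n)%:C != 0 :> R[i].
  by rewrite fmorph_eq0 -[n]/(n.+1.-1) -sp lead_coef_eq0 -size_poly_gt0 sp.
have q0 : q.[0] != 0.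
  by rewrite -[0](rmorph0 (real_complex R)) horner_map revp_horner0.
exists (`|q.[0]| / 2); first by rewrite divr_gt0 ?normr_gt0.
near=> z.
have z0 : z != 0.
  by rewrite -normr_gt0; near: z; apply: near_cinfty_gt; exact: real0.
have /andP[qz _] : `|q.[0]| / 2 <= `|q.[z^-1]| <= `|q.[0]| * 2.
  by near: z; exact: near_cinfty_horner_inv.
rewrite -ler_pdivlMr ?exprn_gt0 ?normr_gt0 // -normrX -normf_div -ceval_revp //.
by rewrite sp.
Unshelve. all: by end_near.
Qed.

(** Letting 1/z tend to 0 kills the constant coefficient; dividing by 1/z then lowers both size and
    order. [F] is general because the Pade bounds hold only in sectors. *)
Lemma small_poly_eq0 (F : set_system R[i]) {FF : ProperFilter F} q N
    (K : R[i]) :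
  F --> @cinfty_nbhs R -> 0 <= K -> (size q <= N)%N ->
  (\forall z \near F, `|q.[z^-1]| <= K * `|z^-1| ^+ N) -> q = 0.
Proof.
move=> Foo K0; elim/poly_ind: q N => // q c IHq [|N].
  by rewrite leqn0 size_poly_eq0 => /eqP.
move=> sq qK.
have c0 : c = 0.
  apply/eqP; apply: contraT => c0.
  have e0 : 0 < `|c| / 2 by rewrite divr_gt0 ?normr_gt0.
  have cvgF r : (fun z : R[i] => r.[z^-1] : R[i]^o) @ F --> (r.[0] : R[i]^o).
    by apply: cvg_trans (@cvg_cinfty_horner_inv r); exact: cvg_app.
  have /cvgrPdist_lt /(_ _ e0) := cvgF (q * 'X + c%:P).
  have /cvgrPdist_lt /(_ _ e0) := cvgF (K *: 'X^(N.+1)).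
  rewrite hornerMXaddC mulr0 add0r hornerZ hornerXn expr0n mulr0 => cvgK cvgc.
  (* Properness of [F] gives one point where both limits are within [|c| / 2], forcing
     [|c| < |c|]. *)
  have [z [qz Kz cz]] : exists z,
     [/\ `|(q * 'X + c%:P).[z^-1]| <= K * `|z^-1| ^+ N.+1,
         `|0 - (K *: 'X^(N.+1)).[z^-1]| < `|c| / 2 &
         `|c - (q * 'X + c%:P).[z^-1]| < `|c| / 2].
    by apply: (@filter_ex _ F); near=> z; split; near: z.
  have : `|c| < `|c| / 2 + `|c| / 2.
    rewrite -{1}[c](subrK (q * 'X + c%:P).[z^-1]).
    rewrite (le_lt_trans (ler_normD _ _)) //.
    rewrite ltrD // (le_lt_trans qz) // (le_lt_trans _ Kz) //.
    by rewrite sub0r normrN hornerZ hornerXn normrM normrX (ger0_norm K0).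
  by rewrite -splitr ltxx.
rewrite c0 addr0 in sq qK *.
rewrite (IHq N) ?mul0r //.
  by move: sq; have [->|q0] := eqVneq q 0; rewrite ?size_poly0 // size_mulX.
near=> z.
have z0 : 0 < `|z^-1|.
  rewrite normfV invr_gt0; near: z; apply: Foo.
  by apply: near_cinfty_gt; exact: real0.
have : `|(q * 'X).[z^-1]| <= K * `|z^-1| ^+ N.+1 by near: z.
by rewrite hornerMX normrM exprSr mulrA ler_pM2r.
Unshelve. all: by end_near.
Qed.

(** On the positive imaginary axis the imaginary part equals the modulus, so the sector meets every
    neighbourhood of infinity. *)
Lemma nontangential_proper (delta : R) : delta < 1 ->
  ProperFilter (nontangential_nbhs delta).
Proof.
move=> d1; split; last exact: nontangential_nbhs_filter.
move=> [M _ /(_ (0 +i* (`|M| + 1)))] /=.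
have t0 : 0 < `|M| + 1 by rewrite ltr_pwDr.
have -> : `|0 +i* (`|M| + 1)| = (`|M| + 1)%:C.
  by rewrite normc_def /= expr0n add0r sqrtr_sqr gtr0_norm.
rewrite -complexIm /= -rmorphM !ltcR gtr_pMl //; apply=> //.
by rewrite (le_lt_trans (ler_norm _)) // ltrDl.
Qed.

(** * Uniqueness and existence of the Pade approximant *)

Lemma pade_unique (s : nat -> R) L M f g :
  pade_approximant s L M f -> pade_approximant s L M g -> f = g.
Proof.
move=> [A [B [[sA sB] B0 -> fs]]] [A' [B' [[sA' sB'] B'0 -> gs]]].
have nz (p : {poly R}) : p.[0] != 0 -> at_inverse p != 0.
  move=> p0; apply: at_inverse_neq0.
  by apply: contra_neq p0 => ->; rewrite horner0.
apply/eqP; rewrite eqr_div ?nz // -!at_inverseM; apply/eqP; congr at_inverse.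
apply/eqP; rewrite -subr_eq0 -(map_poly_eq0 (real_complex R)); apply/eqP.
(* Any aperture in (0, 1) would do: positive to use the estimates, below 1 for a proper filter. *)
have h1 : (0 : R) < 1 / 2 by rewrite divr_gt0.
have Fp : ProperFilter (nontangential_nbhs (1 / 2 : R)).
  by apply: nontangential_proper; rewrite ltr_pdivrMr // mul1r ltr1n.
have /eqO_exP [K1 K10 fK] := fs _ h1.
have /eqO_exP [K2 K20 gK] := gs _ h1.
have ceval0 (p : {poly R}) :
    p.[0] != 0 -> (map_poly (real_complex R) p).[0] != 0.
  by move=> p0; rewrite -[0](rmorph0 (real_complex R)) horner_map fmorph_eq0.
have B0n : 0 < `|ceval B 0| by rewrite normr_gt0; exact: ceval0.
have B0n' : 0 < `|ceval B' 0| by rewrite normr_gt0; exact: ceval0.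
have Fin : nontangential_nbhs (1 / 2 : R) --> @cinfty_nbhs R.
  exact: cvg_within.
(* The two error constants add up, and each denominator is eventually at most twice its value at
   0. *)
pose K : R[i] := (K1 + K2) * (`|ceval B 0| * 2 * (`|ceval B' 0| * 2)).
have K0 : 0 <= K by rewrite !mulr_ge0 // addr_ge0 // ltW.
apply: (small_poly_eq0 (N := (L + M).+1) Fin K0).
- rewrite size_map_poly (leq_trans (size_polyD _ _)) // size_polyN geq_max.
  have sM (p q : {poly R}) : (size p <= L.+1)%N -> (size q <= M.+1)%N ->
      (size (p * q)%R <= (L + M).+1)%N.
    move=> sp sq; rewrite (leq_trans (size_polyMleq _ _)) //.
    rewrite -subn1 leq_subLR add1n (leq_trans (leq_add sp sq)) //.
    by rewrite addSn addnS.
  by rewrite !sM.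
near=> z.
have Bz : `|ceval B 0| / 2 <= `|ceval B z^-1| <= `|ceval B 0| * 2.
  by near: z; apply: Fin; apply: near_cinfty_horner_inv; exact: ceval0.
have Bz' : `|ceval B' 0| / 2 <= `|ceval B' z^-1| <= `|ceval B' 0| * 2.
  by near: z; apply: Fin; apply: near_cinfty_horner_inv; exact: ceval0.
have fz : `|ceval A z^-1 / ceval B z^-1 + moment_sum s (L + M).+1 z|
    <= K1 * `|z ^- (L + M).+1|.
  by near: z; exact: fK.
have gz : `|ceval A' z^-1 / ceval B' z^-1 + moment_sum s (L + M).+1 z|
    <= K2 * `|z ^- (L + M).+1|.
  by near: z; exact: gK.
have nz0 (x y : R[i]) : y / 2 <= `|x| -> 0 < y -> x != 0.
  by move=> yx y0; rewrite -normr_gt0 (lt_le_trans _ yx) // divr_gt0.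
have Bz0 : ceval B z^-1 != 0 by case/andP: Bz => /nz0 ->.
have Bz0' : ceval B' z^-1 != 0 by case/andP: Bz' => /nz0 ->.
(* The moment sums cancel in the difference of the two errors. *)
have -> : (map_poly (real_complex R) (A * B' - A' * B)).[z^-1] =
    (ceval A z^-1 / ceval B z^-1 + moment_sum s (L + M).+1 z
     - (ceval A' z^-1 / ceval B' z^-1 + moment_sum s (L + M).+1 z))
    * (ceval B z^-1 * ceval B' z^-1).
  rewrite rmorphB !rmorphM /= hornerD hornerN !hornerM -!/(ceval _ _).
  by field; rewrite Bz0 Bz0'.
rewrite normrM /K mulrAC ler_pM ?normr_ge0 //; last first.
  rewrite normrM; case/andP: Bz => _ ?; case/andP: Bz' => _ ?.
  by rewrite ler_pM ?normr_ge0.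
rewrite -exprVn normrX in fz gz.
by rewrite mulrDl (le_trans (ler_normB _ _)) // lerD.
Unshelve. all: by end_near.
Qed.

(** [Q1/P1] and [Q2/P2] stand for the consecutive odd and even S-fraction convergents, [-Q0/P0] for
    the P-fraction convergent equal to the latter. *)
Lemma pade_exists (s : nat -> R) n (P0 Q0 P1 Q1 P2 Q2 : {poly R}) : (0 < n)%N ->
  size P0 = n.+1 -> size P1 = n.+1 -> size P2 = n.+1 -> (size Q1 <= n.+1)%N ->
  P1.[0] = 0 -> Q2 * P0 = - (Q0 * P2) -> Q1 * P2 - Q2 * P1 = 1 ->
  (fun z => - (ceval Q0 z / ceval P0 z) + moment_sum s (2 * n) z : R[i]^o)%R
    =O_ (@cinfty_nbhs R) (fun z => z ^- (2 * n).+1 : R[i]^o)%R ->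
  pade_approximant s n (n - 1) (tofrac Q1 / tofrac P1).
Proof.
move=> n0 sP0 sP1 sP2 sQ1 P10 eQ det /eqO_exP [K K0 sK].
have sP1' : (size P1 <= n.+1)%N by rewrite sP1.
exists (revp n Q1), (revp n P1); split.
- rewrite size_revp subn1 prednK // size_revp_root0 //.
  by rewrite -horner_coef0.
- by rewrite revp_horner0 -[n]/(n.+1.-1) -sP1 lead_coef_eq0 -size_poly_gt0 sP1.
- rewrite !at_inverse_revp // invf_div mulrA divfK //.
  by rewrite expf_neq0 // tofrac_eq0 polyX_eq0.
move=> delta _; apply/eqO_exP.
(* Since [n > 0], the required order is exactly the degree of [P1 * P2]. *)
have -> : (n + (n - 1)).+1 = (2 * n)%N.
  by rewrite subn1 -addnS prednK // mul2n addnn.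
have [K1 K10 hK1] := ceval_norm_ge sP1.
have [K2 K20 hK2] := ceval_norm_ge sP2.
have [K3 K30 hK3] := ceval_norm_ge sP0.
(* The first term bounds the gap between consecutive convergents, [K] the P-fraction error. *)
exists (K1^-1 * K2^-1 + K); first by rewrite addr_gt0 // mulr_gt0 ?invr_gt0.
have Fin : nontangential_nbhs delta --> @cinfty_nbhs R by exact: cvg_within.
apply: Fin.
near=> z.
have z1 : 1 < `|z| by near: z; apply: near_cinfty_gt; exact: real1.
have z0 : z != 0 by rewrite -normr_gt0 (lt_trans _ z1).
have zn_gt0 : 0 < `|z| ^+ n by rewrite exprn_gt0 // normr_gt0.
have P1z : K1 * `|z| ^+ n <= `|ceval P1 z| by near: z; exact: hK1.
have P2z : K2 * `|z| ^+ n <= `|ceval P2 z| by near: z; exact: hK2.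
have P0z : K3 * `|z| ^+ n <= `|ceval P0 z| by near: z; exact: hK3.
have sz : `|- (ceval Q0 z / ceval P0 z) + moment_sum s (2 * n) z|
    <= K * `|z ^- (2 * n).+1| by near: z; exact: sK.
have nz (k x : R[i]) : 0 < k -> k * `|z| ^+ n <= `|x| -> x != 0.
  by move=> k0 kx; rewrite -normr_gt0 (lt_le_trans _ kx) // mulr_gt0.
have P1z0 := nz _ _ K10 P1z; have P2z0 := nz _ _ K20 P2z.
have P0z0 := nz _ _ K30 P0z.
have cevalM (p q : {poly R}) : ceval (p * q) z = ceval p z * ceval q z.
  by rewrite /ceval rmorphM hornerM.
have eQz : ceval Q2 z * ceval P0 z = - (ceval Q0 z * ceval P2 z).
  by rewrite -!cevalM eQ /ceval rmorphN hornerN.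
have detz : ceval Q1 z * ceval P2 z - ceval Q2 z * ceval P1 z = 1.
  by rewrite -!cevalM -hornerN -hornerD -rmorphN -rmorphD det rmorph1 hornerE.
rewrite !ceval_revp // invf_div mulrA divfK ?expf_neq0 //.
have Q0E : - (ceval Q0 z / ceval P0 z) = ceval Q2 z / ceval P2 z.
  by apply/eqP; rewrite -mulNr eqr_div // mulNr -eQz.
have -> : ceval Q1 z / ceval P1 z + moment_sum s (2 * n) z =
    (ceval P1 z)^-1 * (ceval P2 z)^-1
    + (- (ceval Q0 z / ceval P0 z) + moment_sum s (2 * n) z).
  rewrite Q0E -[X in _ = X * _ + _]mul1r -detz addrA; congr (_ + _).
  by field; rewrite P1z0 P2z0.
rewrite (le_trans (ler_normD _ _)) // mulrDl lerD //.
  rewrite normrM !normfV normrX mul2n -addnn exprD invfM mulrACA -!invfM.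
  rewrite lef_pV2 ?posrE ?mulr_gt0 ?normr_gt0 //.
  by rewrite ler_pM ?mulr_ge0 ?(ltW zn_gt0) // ltW.
(* The P-fraction error has one order to spare, absorbed by [1 < |z|]. *)
rewrite (le_trans sz) // ler_pM2l // !normfV !normrX.
by rewrite lef_pV2 ?posrE ?exprn_gt0 ?normr_gt0 // ler_eXn2l // ltnW.
Unshelve. all: by end_near.
Qed.

End Infinity.

(** * The odd Stieltjes convergents as Pade approximants *)

Theorem proposition5p4 (R : realType) (kappa k : nat) (s : nat -> R)
  (hs : H_reg kappa k s)
  (n : nat -> nat) (hn : normal_indices s n)
  (a : nat -> {poly R}) (b : nat -> R) (hab : P_fraction s n a b)
  (m : nat -> {poly R}) (l : nat -> R) (hml : S_fraction a b m l)
  (j : nat) (hj : (0 < j)%N) :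
  (exists f : {fraction {poly R}}, pade_approximant s (n j) (n j - 1)%N f) /\
  (forall f : {fraction {poly R}}, pade_approximant s (n j) (n j - 1)%N f ->
     f = tofrac (Q_plus m l (2 * j - 1)%N) / tofrac (P_plus m l (2 * j - 1)%N)).
Proof.
have [n0 ltn _] := hn; have [ha b0 asym] := hab; have [ml Sfrac] := hml.
(* Positivity makes the truncated [n j - 1] a genuine predecessor. *)
have n_gt0 : (0 < n j)%N.
  by case: (j) hj => // i _; exact: leq_ltn_trans (ltn i).
have deg := size_stieltjes_S_fraction n0 ltn ha b0 hml hj.
have [sP2 sP1 _ sQ1] := size_stieltjes j ml.
have [sP0 _] := size_three_term b j n0 ltn ha.
rewrite deg in sP2 sP1 sQ1.
suff pade : pade_approximant s (n j) (n j - 1)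
    (tofrac (Q_plus m l (2 * j - 1)) / tofrac (P_plus m l (2 * j - 1))).
  split; first by eexists; exact: pade.
  by move=> f padef; exact: pade_unique padef pade.
have [odd_j half_j] : odd (2 * j - 1) /\ uphalf (2 * j - 1) = j.
  case: (j) hj => // i _; rewrite mul2n doubleS subn1 /=.
  by rewrite odd_double doubleK.
rewrite /Q_plus /P_plus odd_j half_j.
apply: (pade_exists n_gt0 sP0 _ sP2 sQ1 _ _ (stieltjes_det m l j) (asym j hj)).
- by case: (j) hj sP1.
(* Starting from P_{-1}^+ = 0, each increment of the odd-indexed polynomials is divisible by z. *)
- elim: (j) => [|i] /=; first by rewrite horner0.
  by case: (stieltjes_system m l (0, 1) i) => u v /= u0; rewrite !hornerE subr0.
(* Clearing denominators in the equality of the two continued fractions gives the remaining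
   identity. *)
have := Sfrac j hj; rewrite (stieltjes_S_cfrac1 j ml) -mulNr -tofracN.
move=> /eqP; rewrite eqr_div ?tofrac_eq0 -?size_poly_gt0 ?sP2 ?sP0 //.
by rewrite -!tofracM tofrac_eq mulNr => /eqP.
Qed.
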